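(* Let $q$ be a non-constant $C^2$ and increasing (resp. decreasing) function on $\mathbb{R}$ that solves, for some constant $c$ and all $z\in\mathbb{R}$, $$c^2q''(z)= \int_0^\delta \Bigl(f(q(z+\xi)-q(z),\xi) - f(q(z)-q(z-\xi),\xi)\Bigr)\,d\xi .$$ Suppose that $f(x,\xi)$ has a sign for $x\in(0,\infty)$ (resp. $x\in(-\infty,0)$), i.e. either $f(x,\xi)>0$ for all such $x$ and all $\xi\in(0,\delta)$, or $f(x,\xi)<0$ for all such $x$ and all $\xi\in(0,\delta)$. Then the support of $q'$ is unbounded above and unbounded below.
   Context: Fix $\delta>0$. Let $V:\mathbb{R}\to\mathbb{R}$ be $C^2$, and let $I$ be one of the half-lines $(-\infty,0]$, $[0,\infty)$. Assume: (H1) On $I$, $V$ is non-increasing (if $I=(-\infty,0]$), respectively non-decreasing (if $I=[0,\infty)$), convex, and superquadratic, meaning that $V(x)/x^2$ is a strictly increasing function of $|x|$ for $x\in I\setminus\{0\}$. Moreover $V(0)=V'(0)=0$, $V''(0)>0$, and $V''(x)\le V''(0)+c_1|x|^{\gamma_1}+c_2|x|^{\gamma_2}$ for $x\in\mathbb{R}$, where $c_1,c_2\ge 1$ and $0<\gamma_1\le\gamma_2$. (H2) $k:\mathbb{R}\to\mathbb{R}$ is even, $m:\mathbb{R}\to\mathbb{R}$ is odd, both $m$ and $k$ vanish only at $0$ and are non-decreasing on $[0,\infty)$, and $\int_0^\delta \frac{\xi^2 k(\xi)}{m(\xi)^{\gamma_2+2}}\,d\xi<\infty$, $\int_0^\delta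 \frac{k(\xi)}{m(\xi)}\,d\xi<\infty$. The force density is $f(\eta,\xi)=\partial_\eta W(\eta,\xi)$ with $W(\eta,\xi)=V\left(\frac{\eta}{m(\xi)}\right)k(\xi)$, i.e. $f(\eta,\xi)=V'\left(\frac{\eta}{m(\xi)}\right)\frac{k(\xi)}{m(\xi)}$ (in particular $f(0,\xi)=0$). ''Increasing'' and ''decreasing'' are in the non-strict sense. *)

(* Defs.v *)
From HB Require Import structures.
From mathcomp Require Import all_boot all_order all_algebra.
From mathcomp Require Import all_classical all_reals all_analysis.

Set Implicit Arguments.
Unset Strict Implicit.
Unset Printing Implicit Defensive.
Import Order.TTheory GRing.Theory Num.Theory.
Import numFieldNormedType.Exports.

Local Open Scope ring_scope.
Local Open Scope classical_set_scope.

(* Reclaims the notations from the formal derivative of polynomials. *)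
Local Notation "f ^` ()" := (derive1 f) : ring_scope.
Local Notation "f ^` ( n )" := (derive1n n f) : ring_scope.

Section Peridynamics.
Context {R : realType}.
Implicit Types (V k m q : R -> R) (I : set R).

Local Notation mu := (@lebesgue_measure R).

Definition C2 (g : R -> R) : Prop :=
  [/\ forall x, derivable g x 1,
      forall x, derivable g^`() x 1
    & continuous g^`(2)].

Definition strain_energy V k m (eta xi : R) : R := V (eta / m xi) * k xi.

Definition force_density V k m (eta xi : R) : R :=
  (fun e => strain_energy V k m e xi)^`() eta.

(* Valid also at [m xi = 0], where [_ / 0 = 0] makes both sides vanish. *)
Lemma force_densityE V k m eta xi : (forall x, derivable V x 1) ->
  force_density V k m eta xi = V^`() (eta / m xi) * (k xi / m xi).
Proof.
move=> dV; rewrite /force_density /strain_energy !derive1E.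
have dVx : is_derive (eta / m xi) 1 V ('D_1 V (eta / m xi)) by exact/derivableP.
have dg : is_derive eta (1 : R) ((m xi)^-1 \*: (id : R -> R)) (m xi)^-1.
  by rewrite -[X in is_derive _ _ _ X]mulr1; apply: is_deriveZ.
have gE : (m xi)^-1 \*: (id : R -> R) = (fun e => e / m xi).
  by apply/funext => e; rewrite /= /GRing.scale /= mulrC.
rewrite gE in dg.
have dc := is_deriveZ (k xi) 
  (@is_derive1_comp R V (fun e => e / m xi) eta _ _ dVx dg).
have -> : (fun e => V (e / m xi) * k xi) = k xi \*: (V \o (fun e => e / m xi)).
  by apply/funext => e; rewrite /= /GRing.scale /= mulrC.
by rewrite (@derive_val _ _ _ _ _ _ _ dc) /GRing.scale /= mulrCA.
Qed.

Record H1 V I (c1 c2 gamma1 gamma2 : R) : Prop := {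
  H1_monotone :
    (I = `]-oo, 0] /\ {in I &, {homo V : x y /~ x <= y}}) \/
    (I = `[0, +oo[ /\ {in I &, {homo V : x y / x <= y}});
  H1_convex : convex_function (I : set R^o) V;
  H1_superquadratic : forall x y, I x -> I y -> x != 0 -> y != 0 ->
    `|x| < `|y| -> V x / x ^+ 2 < V y / y ^+ 2;
  H1_V0 : V 0 = 0;
  H1_dV0 : V^`() 0 = 0;
  H1_ddV0 : 0 < V^`(2) 0;
  H1_c1 : 1 <= c1;
  H1_c2 : 1 <= c2;
  H1_gamma1 : 0 < gamma1;
  H1_gamma2 : gamma1 <= gamma2;
  H1_growth : forall x,
    V^`(2) x <= V^`(2) 0 + c1 * `|x| `^ gamma1 + c2 * `|x| `^ gamma2 }.

Record H2 k m (delta gamma2 : R) : Prop := {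
  H2_k_even : forall xi, k (- xi) = k xi;
  H2_m_odd : forall xi, m (- xi) = - m xi;
  H2_k_eq0 : forall xi, k xi = 0 <-> xi = 0;
  H2_m_eq0 : forall xi, m xi = 0 <-> xi = 0;
  H2_k_ndecr : {in `[0, +oo[ &, {homo k : x y / x <= y}};
  H2_m_ndecr : {in `[0, +oo[ &, {homo m : x y / x <= y}};
  H2_int1 : (\int[mu]_(xi in `]0%R, delta[)
    (xi ^+ 2 * k xi / m xi `^ (gamma2 + 2))%:E < +oo)%E;
  H2_int2 : (\int[mu]_(xi in `]0%R, delta[) (k xi / m xi)%:E < +oo)%E }.

Definition force_balance V k m q (z xi : R) : R :=
  force_density V k m (q (z + xi) - q z) xi -
  force_density V k m (q z - q (z - xi)) xi.

(* Integrability is part of being a solution: [\int] is total, with junk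
   values when the integral does not exist. *)
Definition travelling_wave V k m (delta c : R) q : Prop := forall z,
  mu.-integrable `]0, delta[ (EFin \o force_balance V k m q z) /\
  c ^+ 2 * q^`(2) z = \int[mu]_(xi in `]0, delta[) force_balance V k m q z xi.

Definition has_sign_on (f : R -> R -> R) (delta : R) (A : set R) : Prop :=
  (forall x xi, A x -> 0 < xi < delta -> 0 < f x xi) \/
  (forall x xi, A x -> 0 < xi < delta -> f x xi < 0).

Definition fun_support (g : R -> R) : set R := closure [set z | g z != 0].

End Peridynamics.

(* Main.v *)
Require Import Defs.
From HB Require Import structures.
From mathcomp Require Import all_boot all_order all_algebra.
From mathcomp Require Import all_classical all_reals all_analysis.

Set Implicit Arguments.
Unset Strict Implicit.
Unset Printing Implicit Defensive.
Import Order.TTheory GRing.Theory Num.Theory.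
Import numFieldNormedType.Exports.

Local Open Scope ring_scope.
Local Open Scope classical_set_scope.

(* If q' vanished beyond some point, the monotone q would be constant from
   some first point s on, with q y <> q s before s. One-sided difference
   quotients give q''(s) = 0, while at s one of the two force terms is
   f(0, xi) = 0 and the other has a strict sign for every xi in ]0, delta[, so
   the integral on the right-hand side cannot vanish. *)

(** Since [h] is differentiable at [s], its derivative is the limit of the right-hand difference
    quotients alone, and these are all zero. *)
Lemma derive1_right_cst (R : realType) (h : R -> R) (s : R) :
  derivable h s 1 -> (forall y, s <= y -> h y = h s) -> derive1 h s = 0.
Proof.
move=> dh hs; rewrite derive1E /derive cvg_at_rightE //.
apply: cvg_lim => //; apply: cvg_near_cst; near=> t.
rewrite /= hs ?subrr ?scaler0 //.
by rewrite lerDr /GRing.scale /= mulr1 ltW.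
Unshelve. all: by end_near. Qed.

Lemma derive1_left_cst (R : realType) (h : R -> R) (s : R) :
  derivable h s 1 -> (forall y, y <= s -> h y = h s) -> derive1 h s = 0.
Proof.
move=> dh hs; rewrite derive1E /derive cvg_at_leftE //.
apply: cvg_lim => //; apply: cvg_near_cst; near=> t.
rewrite /= hs ?subrr ?scaler0 //.
by rewrite gerDr /GRing.scale /= mulr1 ltW.
Unshelve. all: by end_near. Qed.

Lemma derive1_eq0_itv_cst (R : realType) (q : R -> R) (a b : R) :
  (forall x, derivable q x 1) -> a <= b ->
  (forall x, a < x < b -> derive1 q x = 0) -> q a = q b.
Proof.
move=> dq; rewrite le_eqVlt => /predU1P[-> //|ab q'0].
have dq' x : x \in `]a, b[%R -> is_derive x 1 q (derive1 q x).
  by move=> _; rewrite derive1E; apply/derivableP.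
have cq : {within `[a, b], continuous q}.
  exact: derivable_within_continuous.
have [x xab] := MVT ab dq' cq.
move: xab; rewrite in_itv /= => /q'0 ->; rewrite mul0r => /eqP.
by rewrite subr_eq0 => /eqP ->.
Qed.

(** If the integral of the positive [g] were zero, [g] would vanish almost everywhere; the interval
    would then be negligible, although its measure is [delta]. *)
Lemma integral_gt0_neq0 (R : realType) (delta : R) (g : R -> R) :
  0 < delta ->
  (@lebesgue_measure R).-integrable `]0, delta[ (EFin \o g) ->
  (forall x, 0 < x < delta -> 0 < g x) ->
  \int[@lebesgue_measure R]_(x in `]0, delta[) g x <> 0.
Proof.
move=> d0 ig g0 /eqP.
rewrite /Rintegral fine_eq0; last exact: integrable_fin_num.
move=> /eqP i0.
have : (\int[@lebesgue_measure R]_(x in `]0%R, delta[) `|(EFin \o g) x|)%E = 0%E.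
  rewrite -i0; apply: eq_integral => x; rewrite inE /= in_itv /= => xd.
  by rewrite gtr0_norm // g0.
move=> /ae_eq_integral_abs -/(_ (measurable_itv _) (measurable_int _ ig)).
move=> ae0.
have : (@lebesgue_measure R).-negligible `]0%R, delta[.
  apply: negligibleS ae0 => x /= xd H.
  have := H xd; move: xd; rewrite /= in_itv /= => /g0 + [gx].
  by rewrite gx ltxx.
move=> /negligibleP -/(_ (measurable_itv _)) /= mu0.
have := lebesgue_measure_itv `]0, delta[%R.
rewrite /= mu0 lte_fin d0 sube0 => -[d00].
by move: d0; rewrite -d00 ltxx.
Qed.

(* The second hypothesis (fibres of q are order-convex) holds for increasing
   and for decreasing q, and is invariant under reflection of the variable. *)
Lemma plateau_start (R : realType) (q : R -> R) (M : R) :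
  continuous q ->
  (forall x y z, x <= y -> y <= z -> q x = q z -> q y = q z) ->
  (~ exists a : R, forall z : R, q z = a) ->
  (forall z, M <= z -> q z = q M) ->
  exists s, (forall y, s <= y -> q y = q s) /\ (forall y, y < s -> q y <> q s).
Proof.
move=> cq fibq ncq qM.
pose S := [set z | q z != q M].
have ubS : ubound S M.
  by move=> z; apply: contraPle => /ltW /qM qz; rewrite /S /= qz eqxx.
have supS : has_sup S.
  split; last by exists M.
  apply: contrapT => S0; apply: ncq; exists (q M) => z.
  by apply/eqP/negP => /negP qz; apply: S0; exists z.
(* The plateau starts at [sup S]: beyond it [q] equals [q M], and right-continuity carries this
   value to [sup S] itself. *)
have gt_sup y : sup S < y -> q y = q M.
  move=> sy; apply/eqP/negP => /negP qy.
  by have := sup_ubound supS.2 qy; rewrite leNgt sy.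
have qs : q (sup S) = q M.
  apply: (@cvg_unique _ _ (q x @[x --> (sup S)^'+])) => //.
    exact/cvg_at_right_filter/cq.
  by apply: cvg_near_cst; near=> y; apply: gt_sup.
exists (sup S); rewrite qs; split=> [y|y ys qy].
  by rewrite le_eqVlt => /predU1P[<-//|/gt_sup].
have sy : 0 < sup S - y by rewrite subr_gt0.
(* Some [z] of [S] lies between [y] and [M]; if [q y = q M], order-convexity of the fibre would
   force [q z = q M]. *)
have [z Sz] := sup_adherent sy supS; rewrite subKr => yz.
move/eqP: (Sz); apply.
exact: fibq (ltW yz) (ubS _ Sz) qy.
Unshelve. all: by end_near. Qed.

Lemma force_density0 (R : realType) (V k m : R -> R) (xi : R) :
  (forall x, derivable V x 1) -> derive1 V 0 = 0 ->
  force_density V k m 0 xi = 0.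
Proof. by move=> dV V'0; rewrite force_densityE // mul0r V'0 mul0r. Qed.

(** If [q''] vanished at [s], so would the integral of the force balance, whatever [c] is. The
    factor [r] lets one statement cover both signs of the integrand. *)
Lemma travelling_wave_derive2_neq0 (R : realType) (V k m q : R -> R)
    (delta c s r : R) :
  0 < delta -> travelling_wave V k m delta c q ->
  (forall xi, 0 < xi < delta -> 0 < r * force_balance V k m q s xi) ->
  derive1n 2 q s <> 0.
Proof.
move=> d0 /(_ s)[ifb qs] fb0 q''s.
apply: (integral_gt0_neq0 d0 _ fb0).
  exact: (integrableZl _ r ifb).
by rewrite RintegralZl // -qs q''s !mulr0.
Qed.

Lemma has_sign_onP (R : realType) (f : R -> R -> R) (delta : R) (A : set R) :
  has_sign_on f delta A ->
  exists r, forall x xi, A x -> 0 < xi < delta -> 0 < r * f x xi.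
Proof.
case=> f0; [exists 1|exists (- 1)] => x xi Ax xid.
  by rewrite mul1r f0.
by rewrite mulN1r oppr_gt0 f0.
Qed.

Section no_plateau.
Context (R : realType) (V k m q : R -> R) (delta c r : R) (A : set R).
Context (delta_gt0 : 0 < delta) (V_C2 : C2 V) (dV0 : derive1 V 0 = 0).
Context (q_C2 : C2 q) (q_solves : travelling_wave V k m delta c q).
Context (rf_gt0 : forall x xi, A x -> 0 < xi < delta ->
  0 < r * force_density V k m x xi).
(** [A] stands for the half-line that contains the nonzero increments of [q], so that increasing and
    decreasing waves are treated at once. *)
Context (A_incr : forall x y, x < y -> q x <> q y -> A (q y - q x)).

Let dV x : derivable V x 1. Proof. by case: V_C2. Qed.

Lemma no_right_plateau (s : R) :
  (forall y, s <= y -> q y = q s) -> ~ (forall y, y < s -> q y <> q s).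
Proof.
have [dq dq' _] := q_C2.
move=> qs qns.
(* On a right plateau only the backward force term survives; it is subtracted in the balance, hence
   the factor [- r]. *)
apply: (travelling_wave_derive2_neq0 (s := s) (r := - r) _ q_solves) => //.
  move=> xi /[dup] xid /andP[xi0 _]; rewrite /force_balance.
  rewrite (qs (s + xi)) ?lerDl ?ltW // subrr force_density0 // sub0r mulrNN.
  apply: rf_gt0 => //.
  by apply: A_incr; [rewrite gtrBl|apply: qns; rewrite gtrBl].
(* One-sided quotients are used twice: for [q], giving [q' = 0] from [s] onwards with [s] included,
   then for [q']. *)
apply: derive1_right_cst => // y sy.
have q'0 z : s <= z -> derive1 q z = 0.
  move=> sz; apply: derive1_right_cst => // w zw.
  by rewrite (qs w) ?(qs z) // (le_trans sz).
by rewrite /= !q'0.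
Qed.

Lemma no_left_plateau (s : R) :
  (forall y, y <= s -> q y = q s) -> ~ (forall y, s < y -> q y <> q s).
Proof.
have [dq dq' _] := q_C2.
move=> qs qns.
(* Here the forward term survives and keeps its sign. *)
apply: (travelling_wave_derive2_neq0 (s := s) (r := r) _ q_solves) => //.
  move=> xi /[dup] xid /andP[xi0 _]; rewrite /force_balance.
  rewrite (qs (s - xi)) ?gerBl ?ltW // subrr force_density0 // subr0.
  apply: rf_gt0 => //.
  by apply: A_incr; [rewrite ltrDl|apply/nesym/qns; rewrite ltrDl].
apply: derive1_left_cst => // y sy.
have q'0 z : z <= s -> derive1 q z = 0.
  move=> sz; apply: derive1_left_cst => // w zw.
  by rewrite (qs w) ?(qs z) // (le_trans zw).
by rewrite /= !q'0.
Qed.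

End no_plateau.

Lemma derive1_eq0_outside_support (R : realType) (q : R -> R) (z : R) :
  ~ fun_support (derive1 q) z -> derive1 q z = 0.
Proof.
by apply: contra_notP => /eqP q'z; exact: subset_closure.
Qed.

Theorem proposition11 (R : realType) (delta : R) (V k m : R -> R) (I : set R)
    (c1 c2 gamma1 gamma2 : R) (q : R -> R) (c : R)
    (delta_gt0 : 0 < delta)
    (V_C2 : C2 V)
    (V_H1 : H1 V I c1 c2 gamma1 gamma2)
    (km_H2 : H2 k m delta gamma2)
    (q_C2 : C2 q)
    (q_nonconstant : ~ exists a : R, forall z : R, q z = a)
    (q_solves : travelling_wave V k m delta c q)
    (q_monotone_f_sign :
      ({homo q : x y / x <= y} /\
        has_sign_on (force_density V k m) delta `]0, +oo[) \/
      ({homo q : x y /~ x <= y} /\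
        has_sign_on (force_density V k m) delta `]-oo, 0[)) :
  ~ has_ubound (fun_support q^`()) /\ ~ has_lbound (fun_support q^`()).
Proof.
have [dq _ _] := q_C2.
have cq : continuous q.
  by move=> x; apply/differentiable_continuous/derivable1_diffP.
have fibq x y z : x <= y -> y <= z -> q x = q z -> q y = q z.
  move=> xy yz qxz; apply/eqP; rewrite eq_le.
  by case: q_monotone_f_sign => -[hq _];
    [rewrite -{2}qxz !hq|rewrite -{1}qxz !hq].
have [A [A_incr /has_sign_onP[r rf_gt0]]] : exists A : set R,
    (forall x y, x < y -> q x <> q y -> A (q y - q x)) /\
    has_sign_on (force_density V k m) delta A.
  case: q_monotone_f_sign => -[hq fs]; eexists; (split; last exact: fs).
    move=> x y /ltW xy /eqP qxy /=.
    by rewrite in_itv /= andbT subr_gt0 lt_neqAle qxy hq.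
  move=> x y /ltW xy /eqP qxy /=.
  by rewrite in_itv /= subr_lt0 lt_neqAle eq_sym qxy hq.
have dV0 := H1_dV0 V_H1.
split=> -[M suppM].
  have qM z : M <= z -> q z = q M.
    move=> Mz; apply/esym/derive1_eq0_itv_cst => // x /andP[Mx _].
    by apply: derive1_eq0_outside_support => /suppM; rewrite leNgt Mx.
  have [s [qs qns]] := plateau_start cq fibq q_nonconstant qM.
  exact: (no_right_plateau delta_gt0 V_C2 dV0 q_C2 q_solves rf_gt0 A_incr
    qs qns).
have qM z : z <= M -> q z = q M.
  move=> zM; apply/derive1_eq0_itv_cst => // x /andP[_ xM].
  by apply: derive1_eq0_outside_support => /suppM; rewrite leNgt xM.
(* The reflected profile is constant to the right of [- M]; if its plateau starts at [s], that of
   [q] ends at [- s]. *)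
have [||||s [qs qns]] := @plateau_start R (q \o -%R) (- M).
- by move=> x; apply: continuous_comp; [exact: opp_continuous|exact: cq].
- move=> x y z xy yz /= qxz; rewrite -qxz.
  by apply: fibq (esym qxz); rewrite lerN2.
- move=> [a qa]; apply: q_nonconstant; exists a => z.
  by rewrite -(qa (- z)) /= opprK.
- by move=> z /= Mz; rewrite opprK; apply: qM; rewrite lerNl.
apply: (no_left_plateau delta_gt0 V_C2 dV0 q_C2 q_solves rf_gt0 A_incr
  (s := - s)).
  by move=> y ys; rewrite -[y]opprK; apply: qs; rewrite lerNr.
by move=> y ys; rewrite -[y]opprK; apply: qns; rewrite ltrNl.
Qed.
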